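(* Let $d\ge 1$ and $i\ge 1$, and let $\mathcal S=\{[k_1,l_1],\dots,[k_i,l_i]\}$ be a family of $i$ pairwise disjoint intervals of $[1,d]$ as described in the context (the special interval $[1,d]^*$ is not allowed). Let $j$ be the number of elements of $[1,d]$ not contained in any interval of $\mathcal S$, so that $0\le j\le d-i$. Then $$C_{d,i,j}(x)=\sum_{\pi\in NC(d)} wt_{\mathcal S}(\pi).$$
   Context: For $j\ge 0$ let $g(L_j,x)=\sum_{m=0}^{\lfloor j/2\rfloor}\frac{1}{j-m+1}\binom{j}{m}\binom{2j-2m}{j}(x-1)^m$ (the toric $g$-polynomial of the boundary of the $j$-cube). For $d\ge 0$ define polynomials $Q_{d,k}(x)$, $0\le k\le d+1$, by $Q_{d,0}(x)=(x-1)^{d+1}+\sum_{j=0}^{d}2^{d-j}\binom{d}{j}(x-1)^{d-j}g(L_j,x)$; for $1\le k\le d$, $Q_{d,k}(x)=\sum_{j=k-1}^{d}2^{d-j}\left[\binom{d-k}{d-j}+\binom{d+1-k}{d-j}\right](x-1)^{d-j}g(L_j,x)$; and $Q_{d,d+1}(x)=g(L_d,x)$. For $i>0$ and $0\le j\le d-i$ define $C_{d,i,j}(x)=\sum_{k=j+1}^{i+j}2^{-i}\binom{i-1}{k-1-j}Q_{d,k}(x)$. $NC(d)$ is the set of noncrossing partitions of $[1,d]=\{1,\dots,d\}$. For $\pi\in NC(d)$: an element is a singleton of $\pi$ if it forms a block by itself; $\mathrm{block}(\pi)$ is the number of blocks of $\pi$ of size at least $2$; an element $k\in[1,d]$ is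 an antisingleton of $\pi$ if $k$ and $k+1$ lie in the same block of $\pi$, where $d+1$ is read as $1$. Intervals: for $1\le k,l\le d$, $[k,l]=\{k,k+1,\dots,l\}$ if $k\le l$, and if $k>l$, $[k,l]=\{k,\dots,d,1,\dots,l\}$, called a wrapped interval. A family of pairwise disjoint intervals $\mathcal S=\{[k_1,l_1],\dots,[k_i,l_i]\}$ is listed so that $1\le k_1\le l_1<k_2\le l_2<\dots<k_i\le d$ and either $k_i\le l_i\le d$ or $1\le l_i<k_1$ (so only the last interval can be wrapped). Given $\pi\in NC(d)$ and $\mathcal S$: a singleton element is in $\mathcal S$ if it lies in some interval of $\mathcal S$; an antisingleton $k\le d-1$ is in $\mathcal S$ if $\{k,k+1\}$ is contained in a single interval of $\mathcal S$; the antisingleton $d$ (if $d$ is one) is in $\mathcal S$ if and only if $\mathcal S$ contains a wrapped interval. The weight is $wt_{\mathcal S}(\pi)=x^{\mathrm{block}(\pi)+s+a}$, where $s$ is the number of singleton elements of $\pi$ in $\mathcal S$ and $a$ the number of antisingleton elements of $\pi$ in $\mathcal S$.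
   Formalization: For a wrapped interval [l+1,l], which contains all of [1,d], the antisingleton l is not counted as being in S although {l,l+1} is contained in it as a set; counting it makes the claim false (d=2, S={[2,1]}: x^2+x^3 instead of 2x^2). *)

(* Defs.v *)
From HB Require Import structures.
From mathcomp Require Import all_boot all_order all_algebra.

Set Implicit Arguments.
Unset Strict Implicit.
Unset Printing Implicit Defensive.

Import GRing.Theory.
Local Open Scope ring_scope.

(* The toric g-polynomial of the boundary complex of the j-cube. *)
Definition gL (j : nat) : {poly rat} :=
  \sum_(0 <= m < (j./2).+1)
    ((('C(j, m) * 'C(2 * j - 2 * m, j))%N)%:R / (j - m + 1)%N%:R)
      *: ('X - 1) ^+ m.

(* Meaningful for k <= d.+1 only; any k > d gets the value at k = d.+1. *)
Definition Qpoly (d k : nat) : {poly rat} :=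
  if k == 0%N then
    ('X - 1) ^+ d.+1
    + \sum_(0 <= j < d.+1)
        ((2 ^ (d - j) * 'C(d, j))%N)%:R *: (('X - 1) ^+ (d - j) * gL j)
  else if (k <= d)%N then
    \sum_(k.-1 <= j < d.+1)
      ((2 ^ (d - j) * ('C(d - k, d - j) + 'C(d.+1 - k, d - j)))%N)%:R
        *: (('X - 1) ^+ (d - j) * gL j)
  else gL d.

(* Meaningful for 0 < i and i + j <= d only. *)
Definition Cpoly (d i j : nat) : {poly rat} :=
  \sum_(j.+1 <= k < (i + j).+1)
    ('C(i.-1, k.-1 - j)%:R / 2 ^+ i) *: Qpoly d k.

(* The ground set {1, ..., d} is represented by 'I_d, the number k being the
   ordinal of value k - 1; the cyclic successor of a is [ordS a]. *)

Definition noncrossing (d : nat) (P : {set {set 'I_d}}) : bool :=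
  [forall a : 'I_d, forall b : 'I_d, forall c : 'I_d, forall e : 'I_d,
     [&& (a < b)%N, (b < c)%N, (c < e)%N,
         c \in pblock P a & e \in pblock P b] ==>
     (pblock P a == pblock P b)].

Definition NC (d : nat) : {set {set {set 'I_d}}} :=
  [set P | partition P [set: 'I_d] & noncrossing P].

Definition block (d : nat) (P : {set {set 'I_d}}) : nat :=
  #|[set B in P | (2 <= #|B|)%N]|.

Definition singletons (d : nat) (P : {set {set 'I_d}}) : {set 'I_d} :=
  [set a | [set a] \in P].

Definition antisingletons (d : nat) (P : {set {set 'I_d}}) : {set 'I_d} :=
  [set a | ordS a \in pblock P a].

(* The interval [k, l] is represented by the pair (k, l). *)
Definition wrapped (d : nat) (I : 'I_d * 'I_d) : bool := (I.2 < I.1)%N.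

Definition interval (d : nat) (I : 'I_d * 'I_d) : {set 'I_d} :=
  if wrapped I then [set a : 'I_d | (I.1 <= a)%N || (a <= I.2)%N]
  else [set a : 'I_d | (I.1 <= a)%N && (a <= I.2)%N].

(* k_1 <= l_1 < k_2 <= l_2 < ... < k_i, and k_i <= l_i or l_i < k_1. *)
Definition interval_family (d : nat) (S : seq ('I_d * 'I_d)) : bool :=
  if S is I1 :: S' then
    path (fun J K : 'I_d * 'I_d => (J.1 <= J.2)%N && (J.2 < K.1)%N) I1 S'
    && (let J := last I1 S' in (J.1 <= J.2)%N || (J.2 < I1.1)%N)
  else true.

Definition covered (d : nat) (S : seq ('I_d * 'I_d)) : {set 'I_d} :=
  [set a | has (fun I => a \in interval I) S].

(* [pair_in I a]: the pair {a, a + 1} is contained in [k, l] = k, k + 1, ..., l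
   (read cyclically), i.e. a and a + 1 belong to it and a is not its last
   element l. The condition a != l only matters for the wrapped intervals
   [l + 1, l], see [pair_inE]: such an interval exhausts the ground set but is
   cut between l and l + 1, just as the unwrapped interval from 1 to d is cut
   between d and 1. *)
Definition pair_in (d : nat) (I : 'I_d * 'I_d) (a : 'I_d) : bool :=
  [&& a \in interval I, ordS a \in interval I & a != I.2].

Lemma pair_inE (d : nat) (I : 'I_d * 'I_d) (a : 'I_d) :
  (a.+1 < d)%N -> I.1 != I.2.+1 :> nat ->
  pair_in I a = (a \in interval I) && (ordS a \in interval I).
Proof.
move=> lt_a_d neq; rewrite /pair_in andbA.
case: eqVneq => [ea|_]; last by rewrite andbT.
have -> : (ordS a \in interval I) = false; last by rewrite andbF.
rewrite ea in lt_a_d *; rewrite /interval /wrapped.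
case: ltnP => h; rewrite inE /= modn_small // ltnn ?orbF ?andbF //.
by apply/negbTE; rewrite -ltnNge ltn_neqAle eq_sym neq h.
Qed.

Definition antisingleton_in (d : nat) (S : seq ('I_d * 'I_d)) (a : 'I_d) :
    bool :=
  if (a.+1 < d)%N then has (fun I => pair_in I a) S
  else has (@wrapped d) S.

Definition wt (d : nat) (S : seq ('I_d * 'I_d)) (P : {set {set 'I_d}}) :
    {poly rat} :=
  'X ^+ (block P + #|singletons P :&: covered S|
         + #|[set a in antisingletons P | antisingleton_in S a]|).

(* Main.v *)
(* A noncrossing partition of [1, d] is encoded by the word recording, for each
   element, whether its block has a smaller element (the element closes an arc)
   and whether it has a larger one (it opens an arc); the number of open arcs
   turns such words into Motzkin-like paths. Singletons, blocks of size at
   least 2 and the antisingletons k < d are local statistics of the word; the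
   antisingleton d is not, but rotating [1, d] moves it to a place where it has
   weight 1, since the last element of an interval is never weighted as an
   antisingleton.
   With U and D the raising and lowering operators on heights, so that DU = 1,
   an element acts by Y = (1 + U)(x + D). Put c = x - 1. An uncovered element
   acts by Y - c instead, and weighting the pair {k, k + 1} by x replaces the
   second factor Y by Y + c. Hence the right-hand side is the vacuum expectation
   of Y^i (Y + c)^(d-i-j) (Y - c)^j. The moments of Z = Y - c are the
   polynomials g(L_n), and expanding (Z + c)^i (Z + 2c)^(d-i-j) Z^j with the
   binomial theorem gives C_{d,i,j}. *)
From HB Require Import structures.
From mathcomp Require Import all_boot all_order all_algebra.
From mathcomp Require Import zify ring.
Require Import Defs.

Set Implicit Arguments.
Unset Strict Implicit.
Unset Printing Implicit Defensive.

Import GRing.Theory Num.Theory.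

(** * Noncrossing partitions and words *)

Local Notation letter := (bool * bool)%type.

Definition closes (w : seq letter) k := (nth (false, false) w k).1.
Definition opens (w : seq letter) k := (nth (false, false) w k).2.

(** The truncated subtraction hides a closing letter at height 0; [climbing] rules that out. *)
Fixpoint height w k :=
  if k is k'.+1 then height w k' - closes w k' + opens w k' else 0.

(** The level between the closing and the opening move of letter [k]. In the word of a partition it
    counts the other blocks that have elements on both sides of [k]. *)
Definition base w k := height w k - closes w k.

Definition climbing w n :=
  all (fun k => closes w k ==> (0 < height w k)) (iota 0 n).

Definition motzkin w := climbing w (size w) && (height w (size w) == 0).

Lemma heightS w k : height w k.+1 = base w k + opens w k.
Proof. by []. Qed.

Lemma climbingP w n :
  reflect (forall k, k < n -> closes w k -> 0 < height w k) (climbing w n).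
Proof.
apply: (iffP allP) => [H k ltkn|H k]; last first.
  by rewrite mem_iota => /= ltkn; apply/implyP/H.
by apply/implyP/H; rewrite mem_iota.
Qed.

(* For [a <= b] this says that a and b lie on the same level of the path, which
   stays strictly above that level in between: they end up in the same block. *)
Definition linked w a b :=
  (base w a == base w b) &&
  all (fun c => base w a < height w c.+1) (iota (minn a b) (maxn a b - minn a b)).

Lemma linkedP w a b :
  reflect (base w a = base w b /\
    forall c, minn a b <= c < maxn a b -> base w a < height w c.+1)
  (linked w a b).
Proof.
apply: (iffP andP) => -[/eqP eab H]; split=> //.
  by move=> c lec; apply: (allP H); rewrite mem_iota; lia.
by apply/allP => c; rewrite mem_iota => lec; apply: H; lia.
Qed.

Lemma linked_refl w : reflexive (linked w).
Proof. by move=> a; apply/linkedP; split=> // c; lia. Qed.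

Lemma linked_sym w : symmetric (linked w).
Proof.
have imp a b : linked w a b -> linked w b a.
  by case/linkedP=> e H; apply/linkedP; rewrite minnC maxnC -e.
by move=> a b; apply/idP/idP; apply: imp.
Qed.

Lemma linked_trans w : transitive (linked w).
Proof.
move=> b a c /linkedP[eab Hab] /linkedP[ebc Hbc]; apply/linkedP.
split=> [|k lek]; first by rewrite eab.
have [h|h] := boolP (minn a b <= k < maxn a b); first exact: Hab.
by rewrite eab; apply: Hbc; lia.
Qed.

Lemma linked_opens w a b : a < b -> linked w a b -> opens w a.
Proof.
move=> ltab /linkedP[_ /(_ a)]; rewrite heightS; case: opens => //.
by rewrite addn0 ltnn; apply; lia.
Qed.

Lemma linked_closes w a b : a < b -> linked w a b -> closes w b.
Proof.
move=> ltab /linkedP[e /(_ b.-1)]; rewrite prednK; last by lia.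
rewrite e /base; case: closes => //.
by rewrite subn0 ltnn; apply; lia.
Qed.

(** The partner is the letter that brings the path back to the level [base w a] for the first time;
    the path does return, since it ends at height 0. *)
Lemma opens_linked w a : motzkin w -> a < size w -> opens w a ->
  exists b, [/\ a < b, b < size w & linked w a b].
Proof.
case/andP=> /climbingP climb /eqP h0 lta opa.
have ex : exists k, (a < k) && (height w k <= base w a).
  by exists (size w); rewrite h0 lta.
case: (ex_minnP ex) => k /andP[ltak lehk] kmin.
have lek : k <= size w by apply: kmin; rewrite h0 lta.
case: k ltak lehk kmin lek => // b; rewrite ltnS => leab lehb bmin ltb.
have ltab : a < b.
  rewrite ltn_neqAle leab andbT; apply: contraTneq lehb => <-.
  by rewrite heightS opa; lia.
exists b; split=> //.
have above k : a < k -> k <= b -> base w a < height w k.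
  move=> ltak lekb; rewrite ltnNge; apply/negP => lehk.
  by have := bmin k; rewrite ltak lehk => /(_ isT); lia.
apply/linkedP; split=> [|c lec]; last by apply: above; lia.
have := above b ltab (leqnn b); move: lehb; rewrite heightS /base.
by case: closes; lia.
Qed.

(** The partner is the last [a] before [b] with height at most [base w b]: the path can leave that
    level upwards only by opening there. *)
Lemma closes_linked w b : motzkin w -> b < size w -> closes w b ->
  exists a, a < b /\ linked w a b.
Proof.
case/andP=> /climbingP climb _ ltb clb.
have hpos := climb _ ltb clb.
have hb : height w b = (base w b).+1 by rewrite /base clb; lia.
have ex : exists k, (k <= b) && (height w k <= base w b) by exists 0.
case: (ex_maxnP ex (m := b)) => [k /andP[]//|a /andP[leab leha] amax].
have above k : a < k -> k <= b -> base w b < height w k.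
  move=> ltak lekb; rewrite ltnNge; apply/negP => lehk.
  by have := amax k; rewrite lekb lehk => /(_ isT); lia.
have ltab : a < b by rewrite ltn_neqAle leab andbT; apply/eqP => e; subst a; lia.
exists a; split=> //.
have e : base w a = base w b.
  have := above a.+1 (ltnSn a) ltab; rewrite heightS.
  by move: leha; rewrite /base; case: opens; lia.
by apply/linkedP; rewrite e; split=> // c lec; apply: above; lia.
Qed.

Lemma linked_noncrossing w a b c e : a < b -> b < c -> c < e ->
  linked w a c -> linked w b e -> linked w a b.
Proof.
move=> ltab ltbc ltce /linkedP[eac Hac] /linkedP[ebe Hbe].
(* Closing lowers the height by at most one, so no level between linked letters lies below theirs.
   Hence [base w a <= base w b <= base w c = base w a]. *)
have low k l : k < l -> (forall c, k <= c < l -> base w k < height w c.+1) ->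
    forall c, k < c -> c <= l -> base w k <= base w c.
  move=> ltkl Hkl m ltkm leml; have := Hkl m.-1; rewrite prednK; last by lia.
  by rewrite /base; case: (closes w m); lia.
have h1 : base w a <= base w b.
  by apply: (low a c) => //; try lia; move=> k lek; apply: Hac; lia.
have h2 : base w b <= base w c.
  by apply: (low b e) => //; try lia; move=> k lek; apply: Hbe; lia.
apply/linkedP; split=> [|k lek]; first lia.
by apply: Hac; lia.
Qed.

(** * Mutually inverse maps between noncrossing partitions and Motzkin words *)

Section Partitions.
Variable d : nat.
Implicit Types (P : {set {set 'I_d}}) (a b c e : 'I_d) (B D : {set 'I_d}).

Definition nonmin P a := [exists b in pblock P a, (b < a)%N].
Definition nonmax P a := [exists b in pblock P a, (a < b)%N].
Definition word_of P : seq letter :=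
  [seq (nonmin P a, nonmax P a) | a <- enum 'I_d].
Definition part_of (w : seq letter) : {set {set 'I_d}} :=
  equivalence_partition [rel a b : 'I_d | linked w a b] [set: 'I_d].

Lemma size_word_of P : size (word_of P) = d.
Proof. by rewrite size_map size_enum_ord. Qed.

Lemma nth_word_of P a :
  nth (false, false) (word_of P) a = (nonmin P a, nonmax P a).
Proof. by rewrite (nth_map a) ?size_enum_ord// nth_ord_enum. Qed.

Lemma closes_word_of P a : closes (word_of P) a = nonmin P a.
Proof. by rewrite /closes nth_word_of. Qed.

Lemma opens_word_of P a : opens (word_of P) a = nonmax P a.
Proof. by rewrite /opens nth_word_of. Qed.

Lemma linked_equiv w : 
  {in [set: 'I_d] & &, equivalence_rel [rel a b : 'I_d | linked w a b]}.
Proof.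
move=> a b c _ _ _ /=; split=> [|lab]; first exact: linked_refl.
apply/idP/idP; last exact: linked_trans.
by apply: linked_trans; rewrite linked_sym.
Qed.

Lemma part_of_partition w : partition (part_of w) [set: 'I_d].
Proof. exact: equivalence_partitionP (@linked_equiv w). Qed.

Lemma mem_part_of w a b : (b \in pblock (part_of w) a) = linked w a b.
Proof. by rewrite (pblock_equivalence_partition (@linked_equiv w)) ?inE. Qed.

Lemma part_of_NC w : part_of w \in NC d.
Proof.
rewrite inE part_of_partition /=.
apply/'forall_forallP => a b; apply/'forall_forallP => c e; apply/implyP.
rewrite !mem_part_of => /and5P[ltab ltbc ltce lac lbe].
rewrite eq_pblock ?mem_part_of; first exact: linked_noncrossing ltab ltbc ltce lac lbe.
  by case/and3P: (part_of_partition w).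
by rewrite (cover_partition (part_of_partition w)).
Qed.

Lemma part_ofK w : motzkin w -> size w = d -> word_of (part_of w) = w.
Proof.
move=> mw sw; apply: (@eq_from_nth _ (false, false)) => [|k].
  by rewrite size_word_of.
rewrite size_word_of => ltk; rewrite -[k]/(val (Ordinal ltk)) nth_word_of.
set a := Ordinal ltk.
rewrite [RHS]surjective_pairing; congr pair; apply/idP/idP.
- case/existsP=> b; rewrite mem_part_of linked_sym => /andP[lab ltba].
  exact: linked_closes ltba lab.
- case/(closes_linked mw); first by rewrite sw.
  move=> b [ltba lba]; have ltbd := ltn_trans ltba ltk.
  by apply/existsP; exists (Ordinal ltbd); rewrite mem_part_of linked_sym lba.
- case/existsP=> b; rewrite mem_part_of => /andP[lab ltab].
  exact: linked_opens ltab lab.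
- case/(opens_linked mw); first by rewrite sw.
  move=> b [ltab ltb lab]; rewrite sw in ltb.
  by apply/existsP; exists (Ordinal ltb); rewrite mem_part_of lab.
Qed.

(** The blocks cut by the boundary between [k - 1] and [k], which the height of the path counts. *)
Definition open_blocks P k : {set {set 'I_d}} :=
  [set B in P | [exists b in B, (b < k)%N] && [exists b in B, (k <= b)%N]].

Section Noncrossing.
Variable P : {set {set 'I_d}}.
Hypothesis NCP : P \in NC d.

Let partP : partition P [set: 'I_d].
Proof. by move: NCP; rewrite inE => /andP[]. Qed.
Let trivP : trivIset P. Proof. by case/and3P: partP. Qed.
Let coverP a : a \in cover P. Proof. by rewrite (cover_partition partP) inE. Qed.
Let self a : a \in pblock P a. Proof. by rewrite mem_pblock. Qed.
Let blockP a : pblock P a \in P. Proof. by rewrite pblock_mem. Qed.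

Lemma block_def B a : B \in P -> a \in B -> pblock P a = B.
Proof. exact: def_pblock. Qed.

Lemma NC_crossing B D a b c e : B \in P -> D \in P ->
  a \in B -> c \in B -> b \in D -> e \in D -> a < b -> b < c -> c < e -> B = D.
Proof.
move=> BP DP aB cB bD eD ltab ltbc ltce.
move: NCP; rewrite inE => /andP[_ /forallP/(_ a)/forallP/(_ b)/forallP/(_ c)].
move/forallP/(_ e)/implyP; rewrite (block_def BP aB) (block_def DP bD).
by rewrite ltab ltbc ltce cB eD => /(_ isT)/eqP.
Qed.

Lemma open_blockP k B : reflect
  [/\ B \in P, exists2 b : 'I_d, b \in B & b < k & exists2 b : 'I_d, b \in B & k <= b]
  (B \in open_blocks P k).
Proof.
rewrite inE; apply: (iffP and3P) => -[-> h1 h2]; split=> //.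
- by case/existsP: h1 => b /andP[]; exists b.
- by case/existsP: h2 => b /andP[]; exists b.
- by case: h1 => b bB lb; apply/existsP; exists b; rewrite bB.
- by case: h2 => b bB lb; apply/existsP; exists b; rewrite bB.
Qed.

Lemma open_blocks_nonmin a : (pblock P a \in open_blocks P a) = nonmin P a.
Proof.
rewrite inE blockP /= andb_idr // => _.
by apply/existsP; exists a; rewrite self leqnn.
Qed.

Lemma open_blocks_nonmax a : (pblock P a \in open_blocks P a.+1) = nonmax P a.
Proof.
rewrite inE blockP /= andb_idl // => _.
by apply/existsP; exists a; rewrite self leqnn.
Qed.

Lemma open_blocksS a :
  open_blocks P a.+1 :\ pblock P a = open_blocks P a :\ pblock P a.
Proof.
apply/setP => B; rewrite !in_setD1; case: eqVneq => //= neB.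
have out b : B \in P -> b \in B -> b != a :> nat.
  move=> BP bB; apply: contra_neqN neB => /eqP/val_inj e.
  by rewrite -e (block_def BP bB).
apply/open_blockP/open_blockP => -[BP [b bB hb] [c cB hc]]; split=> //.
- by exists b => //; have := out b BP bB; lia.
- by exists c => //; have := out c BP cB; lia.
- by exists b => //; have := out b BP bB; lia.
- by exists c => //; have := out c BP cB; lia.
Qed.

Lemma height_word_of k : k <= d -> height (word_of P) k = #|open_blocks P k|.
Proof.
elim: k => [|k IH] ltk /=.
  apply/esym/eqP; rewrite cards_eq0; apply/eqP/setP => B; rewrite in_set0.
  by apply/negP => /open_blockP[_ [b]].
rewrite IH ?(ltnW ltk)// -[k]/(val (Ordinal ltk)); set a := Ordinal ltk.
rewrite closes_word_of opens_word_of [RHS](cardsD1 (pblock P a)).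
rewrite [X in X - _](cardsD1 (pblock P a)) open_blocksS.
by rewrite open_blocks_nonmin open_blocks_nonmax addKn addnC.
Qed.

Lemma base_word_of a : base (word_of P) a = #|open_blocks P a :\ pblock P a|.
Proof.
rewrite /base closes_word_of height_word_of ?(ltnW (ltn_ord a))//.
by rewrite (cardsD1 (pblock P a)) open_blocks_nonmin addKn.
Qed.

Lemma word_of_motzkin : motzkin (word_of P).
Proof.
rewrite /motzkin size_word_of height_word_of ?leqnn//; apply/andP; split.
  apply/climbingP => k ltk; rewrite -[k]/(val (Ordinal ltk)) closes_word_of.
  rewrite height_word_of ?(ltnW ltk)// (cardsD1 (pblock P (Ordinal ltk))).
  by rewrite open_blocks_nonmin => ->.
rewrite cards_eq0; apply/eqP/setP => B; rewrite in_set0.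
by apply/negP => /open_blockP[_ _ [b _]]; have := ltn_ord b; lia.
Qed.

(** Another block with elements [y < a < z < k] would cross the block of [a] and [b], so a block
    around [a] stays open up to [b]. *)
Lemma open_blocks_enclosed a b k : b \in pblock P a -> a <= k <= b ->
  open_blocks P a :\ pblock P a \subset open_blocks P k :\ pblock P a.
Proof.
move=> bB lek; have aB := self a; have BP := blockP a.
apply/subsetP => D; rewrite !in_setD1 => /andP[neD] /open_blockP.
case=> DP [y yD lty] [z zD lez]; rewrite neD /=; apply/open_blockP; split=> //.
  by exists y => //; clear -lty lek; lia.
exists z => //; rewrite leqNgt; apply/negP => ltzk.
have neza : z != a :> nat.
  by apply: contra_neqN neD => /eqP/val_inj e; rewrite -(block_def DP zD) e.
have /eqP[] := neD; apply: (@NC_crossing _ _ y a z b) => //;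
  clear -lty lez ltzk neza lek; lia.
Qed.

(** By noncrossing, the same other blocks surround [a] and [b], so the levels agree; at each cut
    between them their own block is open in addition, which keeps the path above. *)
Lemma block_linked a b : b \in pblock P a -> a < b -> linked (word_of P) a b.
Proof.
move=> bB ltab; have sub := open_blocks_enclosed bB.
have aB := self a; have BP := blockP a.
have eB : pblock P b = pblock P a by apply: block_def.
apply/linkedP; rewrite !base_word_of eB; split.
  apply/eqP; rewrite eqn_leq subset_leq_card ?sub ?(ltnW ltab) ?leqnn//=.
  apply/subset_leq_card/subsetP => D; rewrite !in_setD1 => /andP[neD] /open_blockP.
  case=> DP [y yD lty] [z zD lez]; rewrite neD /=; apply/open_blockP; split=> //.
    exists y => //; rewrite ltnNge; apply/negP => leay.
    have ne f u : f \in pblock P a -> u \in D -> u != f :> nat.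
      move=> fB uD; apply: contra_neqN neD => /eqP/val_inj e.
      by rewrite -(block_def DP uD) e; apply: block_def.
    have neya := ne a y aB yD; have nezb := ne b z bB zD.
    have /eqP[] := neD; apply/esym; apply: (@NC_crossing _ _ a y b z) => //;
      clear -leay lty lez neya nezb; lia.
  by exists z => //; clear -lez ltab; lia.
move=> c lec; rewrite height_word_of; last by have := ltn_ord b; lia.
have BK : pblock P a \in open_blocks P c.+1.
  by apply/open_blockP; split; [|exists a|exists b] => //; clear -lec ltab; lia.
by rewrite [X in _ < X](cardsD1 (pblock P a)) BK ltnS subset_leq_card ?sub//; lia.
Qed.

(** Otherwise let [m] be the last element before [b] of the block [B] of [a]. It is linked to [b],
    hence opens, so [B] continues past [b]. Then [B] surrounds [b] in addition to all blocks around
    [m], and the levels of [m] and [b] differ. *)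
Lemma linked_block a b : a < b -> linked (word_of P) a b -> b \in pblock P a.
Proof.
move=> ltab lab; set B := pblock P a; apply/negPn/negP => nbB.
have aB : a \in B := self a; have BP : B \in P := blockP a.
case: (@arg_maxnP _ a [pred y : 'I_d | (y \in B) && (y <= b)] val) => /=.
  by rewrite aB ltnW.
move=> m /andP[mB lemb] mmax.
have neq y : y \in B -> y != b :> nat.
  by move=> yB; apply: contraNneq nbB => /val_inj <-.
have ltmb : m < b by have := neq m mB; clear -lemb; lia.
have lam : linked (word_of P) a m.
  have [ltam|leam] := ltnP a m; first exact: block_linked.
  have /val_inj -> : val a = val m; last exact: linked_refl.
  by apply/eqP; rewrite eqn_leq leam mmax //= aB ltnW.
have lmb : linked (word_of P) m b by apply: linked_trans lab; rewrite linked_sym.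
have eB : pblock P m = B by apply: block_def.
have [e [eBB lteb]] : exists e, e \in B /\ b < e.
  have := linked_opens ltmb lmb; rewrite opens_word_of => /existsP[e].
  rewrite eB => /andP[eBB ltme]; exists e; split=> //.
  rewrite ltnNge; apply/negP => leeb.
  by have := mmax e; rewrite /= eBB leeb => /(_ isT); rewrite leqNgt ltme.
have neB : B != pblock P b by apply: contraNneq nbB => ->.
have : #|open_blocks P m :\ B| < #|open_blocks P b :\ pblock P b|.
  have BK : B \in open_blocks P b :\ pblock P b.
    rewrite in_setD1 neB; apply/open_blockP.
    by split; [|exists m|exists e => //; apply: ltnW].
  rewrite [X in _ < X](cardsD1 B) BK ltnS; apply/subset_leq_card/subsetP => D DK.
  have eBm : e \in pblock P m by rewrite eB.
  have := open_blocks_enclosed eBm (k := b); rewrite eB => /(_ _)/subsetP sub.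
  have {sub} := sub _ D DK; rewrite !in_setD1 => /(_ _)/andP[|neD DKb].
    by clear -ltmb lteb; lia.
  rewrite neD DKb andbT; apply: contraNneq neD => eD.
  move: DK; rewrite in_setD1 => /andP[_ /open_blockP[DP [y yD lty] _]].
  apply/eqP; apply: (@NC_crossing _ _ y m b e) => //.
  by rewrite eD.
by case/linkedP: lmb; rewrite !base_word_of eB => ->; rewrite ltnn.
Qed.

Lemma word_ofK : part_of (word_of P) = P.
Proof.
have ne_P B : B \in P -> exists a, a \in B.
  by move=> BP; apply/set0Pn; apply: contraTneq BP => ->; case/and3P: partP.
have mem a b : linked (word_of P) a b = (b \in pblock P a).
  case: (ltngtP a b) => [lt|lt|/val_inj->]; last by rewrite linked_refl self.
    by apply/idP/idP => h; [apply: linked_block|apply: block_linked].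
  rewrite linked_sym -eq_pblock // eq_sym eq_pblock //.
  by apply/idP/idP => h; [apply: linked_block|apply: block_linked].
have eqb a : pblock (part_of (word_of P)) a = pblock P a.
  by apply/setP => b; rewrite mem_part_of mem.
have pP := part_of_partition (word_of P); case/and3P: (pP) => /eqP cP tP nP.
apply/setP => B; apply/idP/idP => BP.
  have [a aB] : exists a, a \in B.
    by apply/set0Pn; apply: contraTneq BP => ->.
  by rewrite -(def_pblock tP BP aB) eqb blockP.
have [a aB] := ne_P B BP.
by rewrite -(block_def BP aB) -eqb pblock_mem // cP inE.
Qed.

End Noncrossing.
End Partitions.

(** * Enumeration of words *)

Definition letters : seq letter :=
  [:: (false, false); (false, true); (true, false); (true, true)].

Fixpoint words n : seq (seq letter) :=
  if n is n'.+1 then [seq rcons w l | w <- words n', l <- letters]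
  else [:: [::]].

Lemma mem_words n w : (w \in words n) = (size w == n).
Proof.
elim: n w => [|n IH] w; first by case: w.
apply/idP/eqP => [/allpairsP[[u l] /= [un _ ->]]|].
  by move: un; rewrite IH size_rcons => /eqP->.
case/lastP: w => // u l; rewrite size_rcons => -[su].
by apply/allpairsP; exists (u, l); split=> //=; [rewrite IH su|case: l => -[] []].
Qed.

Lemma uniq_words n : uniq (words n).
Proof.
elim: n => // n IH; apply: allpairs_uniq => // -[u l] [v m] _ _ /=.
by move/rcons_inj => -[-> ->].
Qed.

Lemma sum_NC_words (V : nmodType) d (G : seq letter -> V) :
  (\sum_(P in NC d) G (word_of P) = \sum_(w <- words d | motzkin w) G w)%R.
Proof.
rewrite -big_enum -(big_map (@word_of d) xpredT) -[RHS]big_filter.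
apply: perm_big; apply: uniq_perm.
- rewrite map_inj_in_uniq ?enum_uniq // => P Q; rewrite !mem_enum => hP hQ e.
  by rewrite -(word_ofK hP) e word_ofK.
- exact/filter_uniq/uniq_words.
move=> w; rewrite mem_filter mem_words; apply/mapP/andP.
  case=> P; rewrite mem_enum => hP ->.
  by rewrite word_of_motzkin // size_word_of.
case=> mw /eqP sw; exists (part_of d w); last by rewrite part_ofK.
by rewrite mem_enum part_of_NC.
Qed.

(** * Blocks, singletons and antisingletons as local statistics of words *)

Section Statistics.
Variables (d : nat) (P : {set {set 'I_d}}).
Hypothesis NCP : P \in NC d.

Let partP : partition P [set: 'I_d].
Proof. by move: NCP; rewrite inE => /andP[]. Qed.
Let trivP : trivIset P. Proof. by case/and3P: partP. Qed.
Let coverP a : a \in cover P. Proof. by rewrite (cover_partition partP) inE. Qed.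
Let self a : a \in pblock P a. Proof. by rewrite mem_pblock. Qed.
Let blockP a : pblock P a \in P. Proof. by rewrite pblock_mem. Qed.

Lemma mem_singletons a :
  (a \in singletons P) = ~~ nonmin P a && ~~ nonmax P a.
Proof.
rewrite inE; apply/idP/andP => [aP|[/existsPn nmin /existsPn nmax]].
  have e : pblock P a = [set a] by apply: def_pblock; rewrite ?set11.
  split; apply/existsPn => b; rewrite e in_set1; case: eqVneq => // ->;
    by rewrite ltnn.
suff -> : [set a] = pblock P a by [].
apply/setP => b; rewrite in_set1; apply/eqP/idP => [->|bB]; first exact: self.
apply: ord_inj; apply/eqP; rewrite eqn_leq (leqNgt a b) (leqNgt b a).
by have := nmin b; have := nmax b; rewrite bB /= => -> ->.
Qed.

(** Each block of size at least 2 is counted at its least element. *)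
Lemma block_nonmin : block P = #|[set a | nonmax P a && ~~ nonmin P a]|.
Proof.
rewrite /block -[RHS](card_in_imset (f := pblock P)) => [|a b]; last first.
  rewrite !inE => /andP[_ /existsPn na] /andP[_ /existsPn nb] e.
  apply: ord_inj; apply/eqP; rewrite eqn_leq (leqNgt a b) (leqNgt b a).
  have hb := self b; have ha := self a; rewrite e in ha; rewrite -e in hb.
  by have := na b; have := nb a; rewrite ha hb /= => -> ->.
apply: eq_card => B; rewrite inE; apply/andP/imsetP => [[BP]|].
  case/card_gt1P => a0 [b0 [a0B b0B neq]].
  case: (@arg_minnP _ a0 (mem B) val a0B) => a aB amin.
  have e : pblock P a = B by apply: def_pblock.
  exists a => //; rewrite inE; apply/andP; split.
    apply/existsP; rewrite e; have := amin a0 a0B; have := amin b0 b0B.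
    have [ea|nea] := eqVneq a a0.
      exists b0; rewrite b0B ltn_neqAle val_eqE ea neq.
      by rewrite -ea; apply: amin.
    by exists a0; rewrite a0B ltn_neqAle val_eqE nea; apply: amin.
  apply/existsPn => b; rewrite e negb_and -leqNgt.
  by case: (boolP (b \in B)) => //= /amin.
case=> a; rewrite inE => /andP[/existsP[b /andP[bB ltab]] _] ->.
split; first exact: blockP.
apply/card_gt1P; exists a, b; split=> //.
by rewrite -val_eqE ltn_eqF.
Qed.

(** An arc opened at [a] is still the topmost one when its neighbour [b] closes, so the two letters
    are linked. *)
Lemma mem_antisingletons (a b : 'I_d) : b = a.+1 :> nat ->
  (a \in antisingletons P) = nonmax P a && nonmin P b.
Proof.
move=> e; rewrite inE.
have -> : ordS a = b by apply: val_inj; rewrite /= e modn_small // -e.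
have ltab : a < b by rewrite e.
apply/idP/andP => [bB|[oa cb]].
  split; apply/existsP; first by exists b; rewrite bB.
  have eB : pblock P b = pblock P a by apply: def_pblock.
  by exists a; rewrite eB self.
apply: (linked_block NCP ltab); apply/linkedP.
have ob : opens (word_of P) a by rewrite opens_word_of.
have clb : closes (word_of P) b by rewrite closes_word_of.
have h : height (word_of P) b = (base (word_of P) a).+1.
  by rewrite e heightS ob addn1.
split=> [|c lec]; first by rewrite [RHS]/base h clb subn1.
have -> : c = a by move: lec; rewrite e; lia.
by rewrite heightS ob addn1.
Qed.

End Statistics.

Section WordWeight.
Variables cov gap : pred nat.

(* [gap k] marks the pair {k - 1, k}. *)
Definition letter_stat w k : nat :=
  (~~ closes w k && (opens w k || cov k))
  + [&& gap k, opens w k.-1 & closes w k].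

Definition word_stat w n := \sum_(k < n) letter_stat w k.

(** Block minima and singletons are the letters that do not close, hence the single disjunction in
    [letter_stat]. An antisingleton is scored at its successor; [gap 0] and [gap d] are excluded
    because these pairs would wrap around. *)
Lemma NC_stat d (P : {set {set 'I_d}}) : P \in NC d -> ~~ gap 0 -> ~~ gap d ->
  block P + #|singletons P :&: [set a | cov (val a)]|
  + #|antisingletons P :&: [set a | gap (val a).+1]| = word_stat (word_of P) d.
Proof.
move=> NCP g0 gd; rewrite /word_stat big_split /=; congr addn.
  rewrite block_nonmin // -2!sum1_card.
  rewrite [X in X + _]big_mkcond [X in _ + X = _]big_mkcond -big_split /=.
  apply: eq_bigr => a _; rewrite closes_word_of opens_word_of in_setI.
  rewrite mem_singletons // !inE.
  by case: nonmin; case: nonmax; case: cov.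
rewrite -sum1_card big_mkcond /=.
case: d P NCP gd => [|n] P NCP gd; first by rewrite !big_ord0.
rewrite big_ord_recr [RHS]big_ord_recl /= (negbTE g0) add0n.
rewrite !inE (negbTE gd) andbF addn0; apply: eq_bigr => k _.
pose a := widen_ord (leqnSn n) k; pose b := lift ord0 k.
have e : b = a.+1 :> nat by [].
rewrite -[bump 0 k]/(val b) add0n -[val k]/(val a) -/a.
rewrite closes_word_of opens_word_of in_setI (mem_antisingletons NCP e) inE.
by rewrite -[(val a).+1]e; case: gap; case: nonmin; case: nonmax.
Qed.

End WordWeight.

(** * Linear functionals on polynomials and the transfer operator *)

Local Open Scope ring_scope.

Section Moment.
Variables (R : nzRingType) (V : lmodType R).

(** The linear functional that takes the value [g k] at ['X^k]. *)
Definition moment (g : nat -> V) (p : {poly R}) : V :=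
  \sum_(k < size p) p`_k *: g k.

Lemma moment_widen g n (p : {poly R}) : (size p <= n)%N ->
  moment g p = \sum_(k < n) p`_k *: g k.
Proof.
move=> lepn; rewrite /moment (big_ord_widen n (fun k => p`_k *: g k)) //.
rewrite big_mkcond; apply: eq_bigr => k _; case: ltnP => // le.
by rewrite nth_default // scale0r.
Qed.

Lemma moment_linear g : linear (moment g).
Proof.
move=> a p q; pose n := maxn (size p) (size q).
have lep : (size p <= n)%N by rewrite leq_maxl.
have leq : (size q <= n)%N by rewrite leq_maxr.
have ler : (size (a *: p + q)%R <= n)%N.
  by rewrite (leq_trans (size_polyD _ _)) // geq_max leq (leq_trans (size_scale_leq _ _)).
rewrite !(moment_widen g (n := n)) // scaler_sumr -big_split /=.
by apply: eq_bigr => k _; rewrite coefD coefZ scalerDl scalerA.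
Qed.

HB.instance Definition _ g :=
  GRing.isLinear.Build R {poly R} V *:%R (moment g) (moment_linear g).

Lemma momentXn g n : moment g 'X^n = g n.
Proof.
rewrite (moment_widen g (n := n.+1)) ?size_polyXn // big_ord_recr /= big1.
  by rewrite coefXn eqxx scale1r add0r.
by move=> k _; rewrite coefXn ltn_eqF ?ltn_ord // scale0r.
Qed.

(** For these iterates the moment of [p] is [p(f)] applied to [v], so multiplication by ['X] becomes
    [f]. *)
Lemma moment_iter (f : {linear V -> V}) v p :
  moment (fun k => iter k f v) ('X * p) = f (moment (fun k => iter k f v) p).
Proof.
set g := fun k => _; rewrite -[p]coefK poly_def mulr_sumr.
rewrite 2!(linear_sum (moment g)) (linear_sum f); apply: eq_bigr => k _ /=.
by rewrite -commr_polyX -scalerAl -exprSr !linearZ /= !momentXn.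
Qed.

End Moment.

(** * The transfer operator on paths graded by their final height *)

Section Transfer.
Variables (R : comNzRingType) (x : R).
Local Notation c := (x - 1).

Definition lower (v : {poly R}) := drop_poly 1 v.

(* 'X^h stands for a path at height h; an element either starts a block or
   closes an arc, then either ends its block or opens an arc. *)
Definition step v := (1 + 'X) * (x *: v + lower v).

Definition shifted_step v := step v - c *: v.

Lemma shifted_step_linear : linear shifted_step.
Proof.
move=> a u v; rewrite /shifted_step /step /lower drop_polyD drop_polyZ.
rewrite -!mul_polyC; ring.
Qed.

HB.instance Definition _ :=
  GRing.isLinear.Build R {poly R} {poly R} *:%R shifted_step shifted_step_linear.

Lemma lowerXn n : lower 'X^n = if (0 < n)%N then 'X^(n.-1) else 0.
Proof.
rewrite /lower; case: n => [|n]; last by rewrite exprSr -[X in _ * X]expr1 drop_polyMXn_id.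
by rewrite drop_poly_eq0 // expr0 size_poly1.
Qed.

Lemma lowerXM v : lower ('X * v) = v.
Proof. by rewrite -commr_polyX /lower -[X in _ * X]expr1 drop_polyMXn_id. Qed.

Section Rcons.
Variables (w : seq letter) (l : letter).
Local Open Scope nat_scope.

Lemma closes_rcons k : k < size w -> closes (rcons w l) k = closes w k.
Proof. by move=> ltk; rewrite /closes nth_rcons ltk. Qed.

Lemma opens_rcons k : k < size w -> opens (rcons w l) k = opens w k.
Proof. by move=> ltk; rewrite /opens nth_rcons ltk. Qed.

Lemma closes_rcons_size : closes (rcons w l) (size w) = l.1.
Proof. by rewrite /closes nth_rcons ltnn eqxx. Qed.

Lemma opens_rcons_size : opens (rcons w l) (size w) = l.2.
Proof. by rewrite /opens nth_rcons ltnn eqxx. Qed.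

Lemma height_rcons k : k <= size w -> height (rcons w l) k = height w k.
Proof.
elim: k => //= k IH ltk.
by rewrite IH ?(ltnW ltk) // closes_rcons // opens_rcons.
Qed.

Lemma climbing_rcons :
  climbing (rcons w l) (size w).+1 =
  climbing w (size w) && (l.1 ==> (0 < height w (size w))).
Proof.
rewrite /climbing -(addn1 (size w)) iotaD all_cat /= add0n andbT height_rcons //.
rewrite closes_rcons_size; congr andb.
apply: eq_in_all => k; rewrite mem_iota /= add0n => ltk.
by rewrite closes_rcons // height_rcons // ltnW.
Qed.

Lemma word_stat_rcons cov gap : ~~ gap 0 ->
  word_stat cov gap (rcons w l) (size w).+1 =
  word_stat cov gap w (size w) + (~~ l.1 && (l.2 || cov (size w)))
  + [&& gap (size w), opens w (size w).-1 & l.1].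
Proof.
move=> g0; rewrite /word_stat big_ord_recr /= -addnA; congr addn.
  apply: eq_bigr => k _; rewrite /letter_stat closes_rcons // !opens_rcons //.
  exact: leq_ltn_trans (leq_pred k) (ltn_ord k).
rewrite /letter_stat closes_rcons_size opens_rcons_size; congr addn.
have [->|s0] := posnP (size w); first by rewrite (negbTE g0).
by rewrite opens_rcons // ltn_predL.
Qed.

End Rcons.

Section Words.
Variables cov gap : pred nat.
Local Notation wordw w n := (x ^+ word_stat cov gap w n).

(** Besides the height, the weight of the next letter depends on the past only through whether the
    last letter opens. By the default of [nth], the empty word counts as not opening. *)
Definition prefix_sum n b : {poly R} :=
  \sum_(w <- words n | climbing w n && (opens w n.-1 == b))
    wordw w n *: 'X^(height w n).

Definition total n := prefix_sum n false + prefix_sum n true.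

Lemma totalE n :
  total n = \sum_(w <- words n | climbing w n) wordw w n *: 'X^(height w n).
Proof.
rewrite /total addrC [RHS](bigID (fun w => opens w n.-1)) /=; congr (_ + _).
  by apply: eq_bigl => w; rewrite eqb_id.
by apply: eq_bigl => w; rewrite eqbF_neg.
Qed.

Lemma lower_sum (I : Type) (r : seq I) (Q : pred I) (F : I -> {poly R}) :
  lower (\sum_(i <- r | Q i) F i) = \sum_(i <- r | Q i) lower (F i).
Proof. exact: (linear_sum (drop_poly 1)). Qed.

Hypothesis gap0 : ~~ gap 0%N.

(** The new letter either does not close, with weight [x] if it opens or is covered, or closes, with
    weight [x] if the pair is marked and its first element opens. *)
Lemma prefix_sumS n b : prefix_sum n.+1 b =
  'X^b * (x ^+ (b || cov n) *: total n + lower (prefix_sum n false)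
          + x ^+ gap n *: lower (prefix_sum n true)).
Proof.
rewrite totalE /prefix_sum [LHS]big_mkcond.
rewrite -[words n.+1]/[seq rcons w l | w <- words n, l <- letters] big_allpairs_dep.
rewrite !lower_sum !scaler_sumr [X in X + _ + _]big_mkcond.
rewrite [X in _ + X + _]big_mkcond [X in _ + _ + X]big_mkcond -!big_split /=.
rewrite mulr_sumr; apply: eq_big_seq => w; rewrite mem_words => /eqP sw.
rewrite !big_cons big_nil -sw !climbing_rcons !word_stat_rcons //= !height_rcons //.
rewrite !closes_rcons_size !opens_rcons_size /=.
case: (climbing w (size w)) => /=; last by rewrite !addr0 mulr0.
have lowerZ a v : lower (a *: v) = a *: lower v by exact: drop_polyZ.
rewrite !lowerZ !lowerXn; move: (height w (size w)) => h.
by case: b; case: (opens w (size w).-1); case: (gap (size w));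
  case: (cov (size w)); case: h => [|h];
  rewrite /= ?subn0 ?addn0 ?subn1 ?addn1 /= -!mul_polyC ?exprS ?expr0 ?polyCM
    ?polyC1 ?polyC0; ring.
Qed.

Lemma total_rec :
  (forall k, gap k.+1 -> cov k && cov k.+1) ->
  forall n, total n.+1 = shifted_step (total n) +
    (if gap n then c *+ 2 else if cov n then c else 0) *: total n.
Proof.
move=> gc.
(* After a covered letter, opening only adds a factor ['X], so [total n] is [1 + 'X] times the
   lowered opening part. The surplus of a marked pair is therefore [c] times [total n]. *)
have diag n : cov n -> prefix_sum n.+1 true = 'X * prefix_sum n.+1 false.
  by move=> cn; rewrite !prefix_sumS cn; rewrite /= expr0 mul1r !expr1.
move=> n; rewrite {1}/total !prefix_sumS /= expr0 !expr1 mul1r.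
have lowerT : lower (total n) = lower (prefix_sum n false) + lower (prefix_sum n true).
  exact: drop_polyD.
rewrite /shifted_step /step lowerT; case gn: (gap n).
  case: n gn {lowerT} => [|n gn]; first by rewrite (negbTE gap0).
  have /andP[cn cSn] := gc n gn.
  rewrite cSn expr1 /total (diag n cn) lowerXM -!mul_polyC polyCMn polyCB; ring.
rewrite -!mul_polyC.
by case: (cov n); rewrite /= ?expr1 ?expr0 ?polyC0 ?polyCB polyC1; ring.
Qed.

Definition symbol n : {poly R} :=
  \prod_(k < n)
    ('X + (if gap k then c *+ 2 else if cov k then c else 0)%:P).

Lemma total_moment n :
  (forall k, gap k.+1 -> cov k && cov k.+1) ->
  total n = moment (fun k => iter k shifted_step 1) (symbol n).
Proof.
move=> gc; elim: n => [|n IH].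
  rewrite /total /prefix_sum /= !big_cons !big_nil /= /word_stat !big_ord0.
  rewrite /symbol big_ord0 -(expr0 'X) momentXn /=.
  by rewrite /opens /= !expr0 scale1r !addr0.
rewrite total_rec // IH /symbol big_ord_recr /= mulrC mulrDl linearD /=.
by rewrite moment_iter mul_polyC linearZ.
Qed.

Lemma total_motzkin n :
  (total n)`_0 = \sum_(w <- words n | motzkin w) wordw w n.
Proof.
rewrite totalE coef_sum big_mkcond [RHS]big_mkcond.
apply: eq_big_seq => w; rewrite mem_words => /eqP <-; rewrite /motzkin.
case: climbing => //=; rewrite coefZ coefXn eq_sym.
by case: eqP; rewrite ?mulr1 ?mulr0.
Qed.

End Words.
End Transfer.

(** * The moments g(L_n) *)

Local Notation R := {poly rat}.
Local Notation x := ('X : R).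
Local Notation c := ('X - 1 : R).
Local Notation arcs n := (iter n (shifted_step x) 1).

(* [kernel] is z^2 + 2 z + x, the symbol z + 2 + x / z of a step away from height
   0 times z. By the reflection principle (z + 1) Phi_n is kernel^n (z^2 - x), up
   to the constant c^(n+1) that makes the division exact and is invisible in the
   coefficients used: the number of paths of length n ending at height h is, up
   to the factor x^h, the coefficient of z^(n+h+1) in Phi_n. *)
Definition kernel : {poly R} := ('X + 1) ^+ 2 + c%:P.

Fixpoint Phi n : {poly R} :=
  if n is n'.+1 then kernel * Phi n' - (c ^+ n)%:P * ('X + 1) else 'X - 1.

(** At z = -1 the kernel is [c] and z^2 - x is [-c]; this is why adding the constant [c^(n+1)] makes
    the right-hand side divisible by z + 1. *)
Lemma PhiE n :
  ('X + 1) * Phi n = kernel ^+ n * ('X ^+ 2 - x%:P) + (c ^+ n.+1)%:P.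
Proof.
elim: n => [|n IH] /=; first by rewrite expr0 expr1 polyCB polyC1; ring.
rewrite mulrBr mulrCA IH [in RHS]exprS !polyC_exp /kernel !exprS.
move: (c%:P) => C; ring.
Qed.

Lemma coef_kernel_antisym n : (kernel ^+ n * ('X ^+ 2 - x%:P))`_n.+1 = 0.
Proof.
pose Q := kernel ^+ n.+1.
(* n + 1 times the left-hand side is a coefficient of z Q' - (n + 1) Q. *)
have dk : 'X * kernel^`() - kernel = 'X ^+ 2 - x%:P.
  rewrite /kernel !derivE polyCB polyC1; ring.
have e : 'X * Q^`() - Q *+ n.+1 = (kernel ^+ n * ('X ^+ 2 - x%:P)) *+ n.+1.
  by rewrite -dk /Q deriv_exp /= mulrnAr -mulrnBl exprS mulrA -mulrBl mulrC.
have /eqP := congr1 (fun p : {poly R} => p`_n.+1) e.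
rewrite coefB coefXM coef_deriv /= !coefMn subrr eq_sym -mulr_natr mulf_eq0.
by rewrite -polyC_natr polyC_eq0 pnatr_eq0 orbF => /eqP.
Qed.

(** The wall at height 0: the fictitious contribution from height -1, coefficient [n] of [Phi n],
    cancels one of the two level steps. *)
Lemma Phi_boundary n : (Phi n)`_n + (Phi n)`_n.+1 = 0.
Proof.
have := congr1 (fun p : {poly R} => p`_n.+1) (PhiE n).
by rewrite coefD coef_kernel_antisym coefC add0r mulrDl mul1r coefD coefXM.
Qed.

Lemma PhiS_coef n k : (Phi n.+1)`_k.+2 =
  (Phi n)`_k + (Phi n)`_k.+1 *+ 2 + x * (Phi n)`_k.+2.
Proof.
have -> : Phi n.+1 = 'X * ('X * Phi n) + ('X * Phi n) *+ 2 + x%:P * Phi n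
    - (c ^+ n.+1)%:P * ('X + 1).
  rewrite /= /kernel polyCB polyC1; ring.
have z : ('X + 1 : {poly R})`_k.+2 = 0 by rewrite coefD coefX coef1 addr0.
rewrite coefB [X in _ - X]coefCM z mulr0 subr0.
by rewrite 2!coefD coefMn coefCM !coefXM.
Qed.

Lemma coef_arcs n h : (arcs n)`_h = x ^+ h * (Phi n)`_(n + h).+1.
Proof.
elim: n h => [|n IH] h.
  rewrite add0n /= coef1 coefB coefX coef1 subr0.
  by case: h => [|h]; rewrite ?mulr0 // mul1r.
rewrite iterS addSn PhiS_coef.
have stepE v : (shifted_step x v)`_h =
    (if h is h'.+1 then x * v`_h' + v`_h else 0) + v`_h + v`_h.+1.
  rewrite /shifted_step /step /lower coefB mulrDl mul1r coefD coefXM.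
  case: h => [|h] /=; rewrite ?coefD !coefZ !coef_drop_poly ?addn1; ring.
rewrite stepE !IH; case: h {stepE} => [|h].
  have := Phi_boundary n; rewrite addn0 addn1 => /eqP; rewrite addr_eq0 => /eqP->.
  by rewrite expr0 expr1; ring.
rewrite IH ?addnS !exprS; ring.
Qed.

Lemma coef_XD1 n k : (('X + 1 : {poly R}) ^+ n)`_k = 'C(n, k)%:R.
Proof.
rewrite exprDn coef_sum.
under eq_bigr do rewrite expr1n mulr1 coefMn coefXn.
case: (leqP k n) => [lekn|ltnk]; last first.
  rewrite bin_small // big1 // => i _.
  by rewrite gtn_eqF ?mul0rn //; have := ltn_ord i; lia.
rewrite (bigD1 (rev_ord (Ordinal (lekn : (k < n.+1)%N)))) //= subSS subKn // eqxx.
rewrite bin_sub // big1 ?addr0 // => i /eqP ne.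
case: eqP => [e|]; last by rewrite mul0rn.
by case: ne; apply: val_inj => /=; have := ltn_ord i; lia.
Qed.

(** Write z^2 - x = (z - 1)(z + 1) - c, expand the kernel in powers of (z + 1)^2 and cancel z + 1.
    The term [m = n] of the second sum is absorbed by [c^(n+1)]. *)
Lemma Phi_expansion n : Phi n =
  \sum_(m < n.+1) (('X - 1) * ('X + 1) ^+ (2 * (n - m)) * (c ^+ m)%:P) *+ 'C(n, m)
  - \sum_(m < n)
     (('X + 1) ^+ (2 * (n - m)).-1 * (c ^+ m.+1)%:P) *+ 'C(n, m).
Proof.
have X1 : 'X + 1 != 0 :> {poly R} by rewrite -size_poly_eq0 size_XaddC.
apply: (mulfI X1); rewrite PhiE.
pose S m : {poly R} := (('X + 1) ^+ (2 * (n - m)) * (c ^+ m)%:P) *+ 'C(n, m).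
have kE : kernel ^+ n = \sum_(m < n.+1) S m.
  by rewrite exprDn; apply: eq_bigr => m _; rewrite /S exprM polyC_exp.
have e1 : \sum_(m < n.+1)
      (('X - 1) * ('X + 1) ^+ (2 * (n - m)) * (c ^+ m)%:P) *+ 'C(n, m)
    = ('X - 1) * kernel ^+ n :> {poly R}.
  by rewrite kE mulr_sumr; apply: eq_bigr => m _; rewrite /S mulrnAr mulrA.
have e2 : ('X + 1) * \sum_(m < n)
      (('X + 1) ^+ (2 * (n - m)).-1 * (c ^+ m.+1)%:P) *+ 'C(n, m)
    = c%:P * (kernel ^+ n - (c ^+ n)%:P).
  rewrite kE big_ord_recr /= {2}/S subnn binn muln0 expr0 mul1r mulr1n addrK.
  rewrite !mulr_sumr; apply: eq_bigr => m _.
  rewrite /S -mulrnAr mulrA -exprS prednK; last by have := ltn_ord m; lia.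
  by rewrite exprS polyCM mulrnAr mulrnAr mulrCA.
rewrite [RHS]mulrBr e2 e1 (exprS c) polyCM polyCB polyC1; ring.
Qed.

(** All terms are rational multiples of ['C(n, m) * 'C(N, n)] with [N = 2 (n - m)], which leaves an
    identity of rational functions. For [N < n] both sides vanish. *)
Lemma gL_coef n m : (m <= n)%N ->
  'C(n, m)%:R * ('C(2 * (n - m), n)%:R - 'C(2 * (n - m), n.+1)%:R)
  - (if m is m'.+1 then 'C(n, m')%:R * 'C((2 * (n - m)).+1, n.+1)%:R else 0)
  = ('C(n, m) * 'C(2 * n - 2 * m, n))%N%:R / (n - m + 1)%N%:R :> rat.
Proof.
move=> lemn; rewrite -mulnBr natrM; set N := (2 * (n - m))%N.
case: (ltnP N n) => [ltNn|leNn].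
  have lt2 : (N < n.+1)%N := leqW ltNn.
  have lt3 : (N.+1 < n.+1)%N by [].
  rewrite (bin_small ltNn) (bin_small lt2) (bin_small lt3).
  by case: (m) => [|k]; rewrite !mulr0n subrr !mulr0 mul0r subrr.
have e1 : n.+1%:R * 'C(N, n.+1)%:R = (N - n)%N%:R * 'C(N, n)%:R :> rat.
  by rewrite -!natrM mul_bin_left.
have e2 : n.+1%:R * 'C(N.+1, n.+1)%:R = N.+1%:R * 'C(N, n)%:R :> rat.
  by rewrite -!natrM mul_bin_diag.
have {e1 e2} [e1 e2] : 'C(N, n.+1)%:R = (N - n)%N%:R * 'C(N, n)%:R / n.+1%:R :> rat
    /\ 'C(N.+1, n.+1)%:R = N.+1%:R * 'C(N, n)%:R / n.+1%:R :> rat.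
  by split; rewrite -?e1 -?e2 mulrAC divff ?mul1r ?pnatr_eq0.
have -> : (if m is m'.+1 then 'C(n, m')%:R * 'C(N.+1, n.+1)%:R else 0)
    = m%:R * 'C(n, m)%:R / (n - m + 1)%N%:R * 'C(N.+1, n.+1)%:R :> rat.
  case: m lemn @N {leNn} e1 e2 => [|m] lemn N _ _; first by rewrite !mul0r.
  congr (_ * _); rewrite -natrM mul_bin_left addn1 subnSK //.
  by rewrite natrM mulrAC divff ?mul1r // pnatr_eq0 subn_eq0 -ltnNge.
have NE : N%:R = 2 * (n%:R - m%:R) :> rat by rewrite natrM natrB.
clearbody N; rewrite e1 e2 natrB // -[N.+1]addn1 -[n.+1]addn1 !natrD natrB // NE.
have n1 : n%:R + 1 != 0 :> rat by rewrite -[1]/(1%:R) -natrD pnatr_eq0 addn1.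
have nm1 : n%:R - m%:R + 1 != 0 :> rat.
  by rewrite -natrB // -[1]/(1%:R) -natrD pnatr_eq0 addn1.
by field; rewrite n1 nm1.
Qed.

Lemma gL_Phi n : (Phi n)`_n.+1 = gL n.
Proof.
rewrite Phi_expansion coefB !coef_sum.
(* The second sum is shifted by one, so that both are indexed by the power of [c]. *)
pose F m : R := if m is m'.+1
  then c ^+ m * 'C((2 * (n - m)).+1, n.+1)%:R *+ 'C(n, m') else 0.
have -> : \sum_(m < n) ((('X + 1 : {poly R}) ^+ (2 * (n - m)).-1
    * (c ^+ m.+1)%:P) *+ 'C(n, m))`_n.+1 = \sum_(m < n.+1) F m.
  rewrite big_ord_recl add0r; apply: eq_bigr => m _.
  rewrite coefMn coefMC coef_XD1 mulrC /F /= /bump add1n.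
  by congr (_ * 'C(_, _)%:R *+ _); have := ltn_ord m; lia.
rewrite -sumrB /gL.
(* The sum defining [gL] may run up to [n]: for [m > n/2] the binomial vanishes because
   [2n - 2m < n]. *)
rewrite (big_nat_widen _ _ n.+1) ?ltnS ?leq_half2 //; last first.
  by rewrite -divn2 leq_div.
rewrite big_mkord [RHS]big_mkcond /=; apply: eq_bigr => m _.
have lemn : (m <= n)%N by rewrite -ltnS.
transitivity ((('C(n, m) * 'C(2 * n - 2 * m, n))%N%:R / (n - m + 1)%N%:R : rat)
    *: c ^+ m); last first.
  case: ltnP => // ltnm; rewrite [X in (_ * X)%N]bin_small ?muln0 ?mulr0n ?mul0r ?scale0r //.
  by move: ltnm; have := odd_double_half n; lia.
rewrite -gL_coef // coefMn coefMC mulrBl mul1r coefB coefXM coef_XD1 /=.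
rewrite coef_XD1 /F -!mul_polyC !(polyCB, polyCM, polyC_natr).
rewrite -[X in X - _ = _]mulr_natr.
case: (m : nat) => [|m'] /=; rewrite ?polyC0 ?polyCM ?polyC_natr.
  by rewrite !subr0 mulrC mulrA.
rewrite -[X in _ - X = _]mulr_natr.
by move: 'C(n, m'.+1)%:R 'C(n, m')%:R 'C(_, n)%:R 'C(_, n.+1)%:R 'C(_, n.+1)%:R => *; ring.
Qed.

Lemma arcs_gL n : (arcs n)`_0 = gL n.
Proof. by rewrite coef_arcs expr0 mul1r addn0 gL_Phi. Qed.

(** * The polynomials Q and C as moments of the sequence g(L_n) *)

Local Notation gL_moment := (moment (gL : nat -> R^o)).

(** The free bound [M] lets two expansions of different lengths share one index range; surplus terms
    have a zero binomial. *)
Lemma moment_gL_binomial n e M : (n < M)%N ->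
  gL_moment (('X + (c *+ 2)%:P) ^+ n * 'X^e) =
  \sum_(m < M) ((2 ^ m * 'C(n, m))%N)%:R *: (c ^+ m * gL (e + n - m)).
Proof.
move=> ltnM; rewrite exprDn mulr_suml linear_sum /=.
pose F m : R := ((2 ^ m * 'C(n, m))%N)%:R *: (c ^+ m * gL (e + n - m)).
transitivity (\sum_(m < n.+1) F m).
  apply: eq_bigr => m _; have lemn : (m <= n)%N by rewrite -ltnS.
  rewrite -polyC_exp mulrC -mulrnAr mulrA -exprD -polyCMn mulrC mul_polyC.
  rewrite linearZ /= momentXn addnBA // /F scaler_nat.
  rewrite -[RHS]mulrnAl exprMn_n -mulrnA //.
rewrite (big_ord_widen M F) // big_mkcond; apply: eq_bigr => m _.
by case: ltnP => // lt; rewrite /F bin_small ?muln0 ?scale0r.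
Qed.

Lemma Qpoly_moment d k : (0 < k <= d)%N ->
  Qpoly d k = gL_moment (('X + (c *+ 2)%:P) ^+ (d - k) * 'X^k
                         + ('X + (c *+ 2)%:P) ^+ (d.+1 - k) * 'X^(k.-1)).
Proof.
case: k => // k /andP[_ ltkd]; rewrite /Qpoly ltkd /= subSS linearD /=.
rewrite !(moment_gL_binomial _ (M := (d - k).+1)) //; last by lia.
rewrite -big_split /= big_nat_rev -[X in \sum_(X <= _ < _) _]add0n big_addn.
rewrite subSn ?(ltnW ltkd) // big_mkord; apply: eq_bigr => m _.
have lemd : (m <= d)%N by have := ltn_ord m; lia.
have -> : (0 + k + d.+1 - (m + k).+1 = d - m)%N by lia.
by rewrite subKn // !subnKC ?(ltnW ltkd) // mulnDr natrD scalerDl.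
Qed.

(** With Z for ['X] and Y = Z + 2c, one has Y + Z = 2(Z + c), so (Z + c)^i is 2^(-i) (Y + Z)^(i-1)
    (Y + Z). The power expands into the coefficients of C, and the last factor yields the two
    summands of [Qpoly_moment]. *)
Lemma Cpoly_moment d i j : (0 < i)%N -> (i + j <= d)%N ->
  Cpoly d i j = gL_moment (('X + c%:P) ^+ i
                           * ('X + (c *+ 2)%:P) ^+ (d - i - j) * 'X^j).
Proof.
case: i => // i _ leijd; rewrite /Cpoly; set Y := 'X + (c *+ 2)%:P.
rewrite -[X in \sum_(X <= _ < _) _]add0n big_addn.
have -> : ((i.+1 + j).+1 - j.+1 = i.+1)%N by lia.
rewrite big_mkord /=.
have twoY : Y + 'X = ('X + c%:P) *+ 2 by rewrite /Y polyCMn !mulr2n; ring.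
have -> : ('X + c%:P) ^+ i.+1 * Y ^+ (d - i.+1 - j) * 'X^j
    = \sum_(t < i.+1) ('C(i, t)%:R / 2 ^+ i.+1)%:P%:P
        * (Y ^+ (d - (t + j.+1)) * 'X^(t + j.+1)
           + Y ^+ (d.+1 - (t + j.+1)) * 'X^(t + j)).
  have two : (2 ^+ i.+1)^-1 * 2 ^+ i.+1 = 1 :> rat.
    by rewrite mulVf // expf_neq0.
  have e : ('X + c%:P) ^+ i.+1 = (2 ^+ i.+1)^-1%:P%:P * (Y + 'X) ^+ i.+1.
    rewrite twoY [X in _ * X]exprMn_n mulrnAr -mulrnAl -!polyCMn -[_ *+ _]mulr_natr natrX.
    by rewrite two mul1r.
  rewrite e (exprS (Y + 'X)) (exprDn Y).
  move: (2 ^- i.+1) => r {two e}.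
  rewrite -!mulrA mulr_suml !mulr_sumr; apply: eq_bigr => t _.
  have let' : (t <= i)%N by rewrite -ltnS.
  have -> : (d - (t + j.+1) = (i - t) + (d - i.+1 - j))%N by lia.
  have -> : (d.+1 - (t + j.+1) = ((i - t) + (d - i.+1 - j)).+1)%N by lia.
  rewrite addnS !exprS !exprD -[_ *+ 'C(i, t)]mulr_natl !polyCM !polyC_natr.
  by move: (Y ^+ (i - t)) (Y ^+ (d - _ - j)) (r%:P%:P) => *; ring.
rewrite linear_sum /=; apply: eq_bigr => t _.
rewrite Qpoly_moment; last by have := ltn_ord t; lia.
by rewrite addnS /= addnK [in RHS]mul_polyC linearZ /= -[LHS]mul_polyC.
Qed.

(** * Rotation *)

Section Rotation.
Variable d : nat.
Implicit Types (P : {set {set 'I_d}}) (A B : {set 'I_d}) (a b : 'I_d).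

Definition rotate_set A : {set 'I_d} := [set ordS a | a in A].
Definition rotate_part P : {set {set 'I_d}} := [set rotate_set B | B in P].

(** Arbitrary sets of weighted singletons and antisingletons are allowed, so that both can be
    rotated. *)
Definition NC_sum A B : R :=
  \sum_(P in NC d)
    'X ^+ (block P + #|singletons P :&: A| + #|antisingletons P :&: B|).

Lemma ordS_onto a : exists b, a = ordS b.
Proof. by case: (ordS_bij d) => g _ gK; exists (g a); rewrite gK. Qed.

Lemma mem_rotate A a : (ordS a \in rotate_set A) = (a \in A).
Proof. exact: mem_imset (@ordS_inj d). Qed.

Lemma rotate_inj : injective rotate_set.
Proof. exact/imset_inj/ordS_inj. Qed.

Lemma mem_rotate_part P B : (rotate_set B \in rotate_part P) = (B \in P).
Proof. exact: mem_imset rotate_inj. Qed.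

Lemma rotate_part_partition P :
  partition (rotate_part P) [set: 'I_d] = partition P [set: 'I_d].
Proof.
rewrite -(imset_partition P _ (@ordS_inj d)); congr partition.
by apply/esym/setP => a; have [b ->] := ordS_onto a; rewrite mem_rotate !inE.
Qed.

Lemma pblock_rotate P a : P \in NC d ->
  pblock (rotate_part P) (ordS a) = rotate_set (pblock P a).
Proof.
rewrite inE => /andP[pP _]; have := pP; rewrite -rotate_part_partition.
case/and3P=> _ tQ _; have /and3P[cP _ _] := pP.
by apply: def_pblock; rewrite ?mem_rotate_part ?mem_rotate ?pblock_mem ?mem_pblock
  // (eqP cP) inE.
Qed.

Lemma ordS_lt a b : (ordS a < ordS b)%N ->
  (a < b /\ b.+1 < d)%N \/ a.+1 = d /\ (b.+1 < d)%N.
Proof.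
have hb : (b.+1 < d)%N \/ b.+1 = d by have := ltn_ord b; lia.
have ha : (a.+1 < d)%N \/ a.+1 = d by have := ltn_ord a; lia.
rewrite /=; case: hb => [hb|->]; last by rewrite modnn.
rewrite (modn_small hb); case: ha => [ha|ha]; last by right.
by rewrite modn_small //; left.
Qed.

Lemma rotate_NC P : P \in NC d -> rotate_part P \in NC d.
Proof.
move=> NCP; have := NCP; rewrite inE => /andP[pP _].
rewrite inE rotate_part_partition pP.
have blk b : pblock P b \in P.
  by rewrite pblock_mem // (cover_partition pP) inE.
have self b : b \in pblock P b by rewrite mem_pblock (cover_partition pP) inE.
have /and3P[_ tP _] := pP.
apply/'forall_forallP => a b; apply/'forall_forallP => e f; apply/implyP.
have [{}a ->] := ordS_onto a; have [{}b ->] := ordS_onto b.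
have [{}e ->] := ordS_onto e; have [{}f ->] := ordS_onto f.
rewrite !pblock_rotate // !mem_rotate.
case/and5P=> /ordS_lt ab /ordS_lt be /ordS_lt ef ea fb; rewrite (inj_eq rotate_inj).
apply/eqP.
have [hb he hf] : [/\ (b.+1 < d)%N, (e.+1 < d)%N & (f.+1 < d)%N].
  by split; [case: ab|case: be|case: ef] => -[].
have {}be : (b < e)%N by case: be => -[//]; clear -hb; lia.
have {}ef : (e < f)%N by case: ef => -[//]; clear -he; lia.
(* If [a] is the last element, the crossing before rotation reads [b < e < f < a]. *)
case: ab => -[ab _]; first exact: (NC_crossing NCP _ _ (self a) ea (self b) fb).
have fa : (f < a)%N by clear -ab hf; lia.
have e1 : pblock P e = pblock P a by apply: def_pblock.
by rewrite (NC_crossing NCP _ _ (self b) fb (self e) _ be ef fa) ?e1.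
Qed.

Lemma rotate_part_inj : injective rotate_part.
Proof. exact/imset_inj/rotate_inj. Qed.

(** Rotation maps the finite set [NC d] injectively into itself, hence onto itself. *)
Lemma rotate_NC_eq P : (rotate_part P \in NC d) = (P \in NC d).
Proof.
have e : [set rotate_part Q | Q in NC d] = NC d.
  apply/eqP; rewrite eqEcard card_imset ?leqnn ?andbT; last exact: rotate_part_inj.
  by apply/subsetP => _ /imsetP[Q hQ ->]; apply: rotate_NC.
by rewrite -[in LHS]e mem_imset //; apply: rotate_part_inj.
Qed.

Lemma rotate_setI A B : rotate_set A :&: rotate_set B = rotate_set (A :&: B).
Proof.
by apply/setP=> a; have [{}a ->] := ordS_onto a; rewrite in_setI !mem_rotate in_setI.
Qed.

Lemma card_rotate A : #|rotate_set A| = #|A|.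
Proof. exact: card_imset (@ordS_inj d). Qed.

Lemma rotate_block P : block (rotate_part P) = block P.
Proof.
rewrite /block -[RHS](card_imset _ rotate_inj); apply: eq_card => B.
apply/idP/imsetP => [|[D hD ->]]; rewrite inE.
  case/andP=> /imsetP[D DP ->]; rewrite card_rotate => lt.
  by exists D; rewrite // inE DP.
by move: hD; rewrite inE mem_rotate_part card_rotate.
Qed.

Lemma rotate_singletons P : singletons (rotate_part P) = rotate_set (singletons P).
Proof.
apply/setP=> a; have [{}a ->] := ordS_onto a; rewrite mem_rotate !inE.
by rewrite -[RHS]mem_rotate_part /rotate_set imset_set1.
Qed.

Lemma rotate_antisingletons P : P \in NC d ->
  antisingletons (rotate_part P) = rotate_set (antisingletons P).
Proof.
move=> NCP; apply/setP=> a; have [{}a ->] := ordS_onto a.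
by rewrite mem_rotate !inE pblock_rotate // mem_rotate.
Qed.

Lemma NC_sum_rotate A B : NC_sum (rotate_set A) (rotate_set B) = NC_sum A B.
Proof.
rewrite /NC_sum (reindex_inj rotate_part_inj) /=.
apply: eq_big => [P|P]; rewrite rotate_NC_eq // => NCP.
rewrite rotate_block rotate_singletons rotate_antisingletons //.
by rewrite !rotate_setI !card_rotate.
Qed.

Definition val_in A : pred nat := [pred k | k \in [seq val a | a in A]].

Lemma val_inE A a : val_in A a = (a \in A).
Proof. by rewrite /val_in /= mem_image //; apply: val_inj. Qed.

Lemma val_inP A k : reflect (exists2 a, a \in A & k = val a) (val_in A k).
Proof. exact: imageP. Qed.

Lemma symbol_val_in A (G : {set 'I_d}) : G \subset A ->
  symbol x (val_in A) (val_in G) d =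
  ('X + c%:P) ^+ (#|A| - #|G|) * ('X + (c *+ 2)%:P) ^+ #|G| * 'X ^+ (d - #|A|).
Proof.
move=> GA; rewrite /symbol.
under eq_bigr do rewrite !val_inE.
rewrite (bigID (mem G)) (bigID (mem A) (fun k => k \notin G)) /=.
rewrite mulrCA mulrA; congr (_ * _ * _).
- rewrite -(cardsDS GA) -prodr_const; apply: eq_big => [k|k].
    by rewrite in_setD.
  by move=> /andP[/negbTE-> ->].
- by rewrite -prodr_const; apply: eq_bigr => k ->.
have -> : (d - #|A| = #|~: A|)%N by rewrite [RHS]cardsCs card_ord setCK.

rewrite -prodr_const; apply: eq_big => [k|k].
  rewrite in_setC andb_idl //; apply: contra; exact: (subsetP GA).
by case/andP=> /negbTE-> /negbTE->; rewrite polyC0 addr0.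
Qed.

(** Induction on the distance from the unweighted element [a0] to the end. Once rotation has moved
    it there, no weighted pair wraps around and the word encoding applies. *)
Lemma NC_sum_moment A B a0 : a0 \notin B ->
  (forall a, a \in B -> (a \in A) && (ordS a \in A)) ->
  NC_sum A B = gL_moment
    (('X + c%:P) ^+ (#|A| - #|B|) * ('X + (c *+ 2)%:P) ^+ #|B| * 'X ^+ (d - #|A|)).
Proof.
have [n] := ubnP (d - a0); elim: n a0 A B => // n IH a0 A B ltn a0B BA.
have [lt|ge] := ltnP a0.+1 d.
  rewrite -NC_sum_rotate (IH (ordS a0)) ?mem_rotate ?card_rotate //.
    by rewrite /= modn_small //; clear -ltn lt; lia.
  move=> a; have [{}a ->] := ordS_onto a; rewrite !mem_rotate; exact: BA.
have ea0 : a0.+1 = d by have := ltn_ord a0; clear -ge; lia.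
(* [gap k] marks the pair ending at [k] whereas [B] lists first elements, hence the rotation of
   [B]. *)
pose cov := val_in A; pose gap := val_in (rotate_set B).
have gap0 : ~~ gap 0%N.
  apply/val_inP => -[b /imsetP[b' b'B ->]] /=.
  have [lt|ge'] := ltnP b'.+1 d; first by rewrite modn_small.
  have eb : b' = a0 by apply: val_inj => /=; have := ltn_ord b'; clear -ea0 ge'; lia.
  by rewrite -eb b'B in a0B.
have gapS (a : 'I_d) : gap a.+1 = (a \in B).
  have [lt|ge'] := ltnP a.+1 d.
    have -> : a.+1 = ordS a by rewrite /= modn_small.
    by rewrite /gap val_inE mem_rotate.
  have -> : a = a0 by apply: val_inj => /=; have := ltn_ord a; clear -ea0 ge'; lia.
  rewrite (negbTE a0B) ea0; apply/val_inP => -[b _ e].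
  by have := ltn_ord b; rewrite -e ltnn.
have gapc k : gap k.+1 -> cov k && cov k.+1.
  move=> gk; have ltk : (k.+1 < d)%N by case/val_inP: (gk) => b _ ->; apply: ltn_ord.
  pose a := Ordinal (ltnW ltk).
  have -> : k.+1 = ordS a by rewrite /= modn_small.
  by rewrite -[k]/(val a) /cov !val_inE; apply: BA; rewrite -gapS.
have gapd : ~~ gap d.
  by apply/val_inP => -[b _ e]; have := ltn_ord b; rewrite -e ltnn.
have eA : [set a | cov (val a)] = A by apply/setP => a; rewrite inE /cov val_inE.
have eB : [set a | gap (val a).+1] = B by apply/setP => a; rewrite inE gapS.
rewrite -(card_rotate B) -symbol_val_in; last first.
  by apply/subsetP => _ /imsetP[b bB ->]; case/andP: (BA b bB).
have := total_motzkin x cov gap d; rewrite total_moment //.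
rewrite coef_sum => e; transitivity (\sum_(w <- words d | motzkin w)
    x ^+ word_stat cov gap w d).
  rewrite -sum_NC_words; apply: eq_bigr => P NCP.
  by rewrite -(NC_stat cov NCP gap0 gapd) eA eB.
rewrite -e /moment; apply: eq_bigr => k _.
by rewrite coefZ arcs_gL.
Qed.

End Rotation.

(** * Families of intervals *)

Section Intervals.
Variables (d : nat) (S : seq ('I_d * 'I_d)).
Local Open Scope nat_scope.
Implicit Types (I J : 'I_d * 'I_d) (a : 'I_d).

Lemma mem_interval I a : (a \in interval I) =
  if I.2 < I.1 then (I.1 <= a) || (a <= I.2) else (I.1 <= a <= I.2).
Proof. by rewrite /interval /wrapped; case: ifP => _; rewrite inE. Qed.

Lemma end_in_interval I : I.2 \in interval I.
Proof. by rewrite mem_interval; case: ltnP => h; rewrite leqnn ?orbT ?h. Qed.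

Lemma interval_step I a : a \in interval I -> a != I.2 -> ordS a \in interval I.
Proof.
rewrite -val_eqE !mem_interval /= => aI neq.
have := ltn_ord I.1; have := ltn_ord I.2.
have [lt|ge] := ltnP a.+1 d.
  by rewrite modn_small //; move: aI neq; case: ltnP => /=; lia.
have -> : a.+1 = d by have := ltn_ord a; lia.
by rewrite modnn; move: aI neq ge; case: ltnP => /=; lia.
Qed.

(** This removes the special case of the last element: an interval contains it without ending there
    exactly when it is wrapped. *)
Lemma antisingleton_inE a :
  antisingleton_in S a = has (fun I => (a \in interval I) && (a != I.2)) S.
Proof.
rewrite /antisingleton_in; case: ltnP => h; apply: eq_has => I.
  rewrite /pair_in; case: (boolP (a \in _)) => //= aI.
  by rewrite andb_idl // => /(interval_step aI).
rewrite /wrapped mem_interval -val_eqE /=.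
have := ltn_ord I.1; have := ltn_ord I.2; have := ltn_ord a.
by move: h; case: (ltnP I.2 I.1) => /=; lia.
Qed.

Definition ends : {set 'I_d} := [set a in map snd S].

Lemma ends_covered : ends \subset covered S.
Proof.
apply/subsetP => a; rewrite !inE => /mapP[I IS ->]; apply/hasP; exists I => //.
exact: end_in_interval.
Qed.

Hypothesis famS : interval_family S.

(** The form in which disjointness of the intervals enters the counting. *)
Lemma interval_ends_apart I0 m n : m < size S -> n < size S -> m != n ->
  (nth I0 S m).2 \notin interval (nth I0 S n).
Proof.
move=> ltm ltn neq; pose r := fun J K : 'I_d * 'I_d => (J.1 <= J.2) && (J.2 < K.1).
have r_trans : transitive r by move=> J I K; rewrite /r; lia.
have [sortedS lastS] : sorted r S /\
    let J := nth I0 S (size S).-1 in J.1 <= J.2 \/ J.2 < (nth I0 S 0).1.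
  case: (S) famS ltm => // I1 S' /andP[pathS /orP h] _.
  by rewrite nth_last.
have ord k l : k < l -> l < size S ->
    (nth I0 S k).1 <= (nth I0 S k).2 < (nth I0 S l).1.
  move=> ltkl ltl; apply: (sorted_ltn_nth r_trans I0 sortedS) => //.
  exact: ltn_trans ltl.
have ends k : k < size S -> (nth I0 S k).1 <= (nth I0 S k).2 \/
    (nth I0 S k).2 < (nth I0 S 0).1.
  move=> ltk; have [ltk'|ge] := ltnP k (size S).-1.
    by left; have := ord k _ ltk'; lia.
  by have -> : k = (size S).-1 by lia.
have start k : k < size S -> (nth I0 S 0).1 <= (nth I0 S k).1.
  by case: k => // k ltk; have := ord 0 k.+1 isT ltk; lia.
rewrite mem_interval.
have := ends m ltm; have := ends n ltn; have := start m ltm; have := start n ltn.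
have [lt|le] := ltnP m n.
  by have := ord m n lt ltn; case: (ltnP (nth I0 S n).2 (nth I0 S n).1) => /=; lia.
have lt : n < m by lia.
by have := ord n m lt ltm; case: (ltnP (nth I0 S n).2 (nth I0 S n).1) => /=; lia.
Qed.

Lemma card_ends : #|ends| = size S.
Proof.
rewrite cardsE -(size_map snd); apply/card_uniqP.
case: (S) (@interval_ends_apart) => // I1 S' apart.
apply/(uniqP I1.2) => m n; rewrite !inE size_map => ltm ltn.
rewrite !(nth_map I1) // => e; apply/eqP/negPn/negP => neq.
by have := apart I1 m n ltm ltn neq; rewrite e end_in_interval.
Qed.

(** An end of one interval lies in no other, so it cannot be weighted through another interval. With
    [card_ends] this leaves [d - i - j] weighted positions. *)
Lemma antisingleton_in_covered :
  [set a | antisingleton_in S a] = covered S :\: ends.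
Proof.
apply/setP => a; rewrite in_setD !inE antisingleton_inE.
apply/hasP/andP => [[I IS /andP[aI neq]]|[nend /hasP[I IS aI]]].
  split; last by apply/hasP; exists I.
  apply/mapP => -[J JS e]; move: neq; rewrite e.
  have [eIJ|neIJ] := eqVneq I J; first by rewrite eIJ eqxx.
  have := @interval_ends_apart I (index J S) (index I S).
  rewrite !index_mem !nth_index // => /(_ JS IS); rewrite -e aI => h _.
  suff : false by [].
  apply: h; apply: contra neIJ => /eqP eidx.
  by rewrite -(nth_index I IS) -(nth_index I JS) eidx.
exists I => //; rewrite aI; apply: contraNneq nend => ->.
exact: map_f.
Qed.

End Intervals.

Theorem theorem4p11 (d i : nat) (S : seq ('I_d * 'I_d)) (j : nat) :
  (1 <= d)%N -> (1 <= i)%N ->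
  size S = i -> interval_family S ->
  j = #|~: covered S| ->
  (i + j <= d)%N /\ Cpoly d i j = \sum_(P in NC d) wt S P.
Proof.
move=> _ ipos sS famS ej.
have card_e := card_ends famS; rewrite sS in card_e.
have sub := ends_covered S; have leiA := subset_leq_card sub.
rewrite card_e in leiA.
have Ad : (#|covered S| + j = d)%N by rewrite ej cardsC card_ord.
have leijd : (i + j <= d)%N by lia.
split=> //; rewrite Cpoly_moment //.
pose B := [set a | antisingleton_in S a].
have eB : B = covered S :\: ends S by apply: antisingleton_in_covered.
have eA : #|covered S| = (d - j)%N by rewrite -[d in RHS]Ad addnK.
have cB : #|B| = (d - i - j)%N by rewrite eB cardsDS // card_e eA; lia.
(* As [i >= 1] there is an interval; its last element is the unweighted element that [NC_sum_moment]
   asks for. *)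
have [I IS] : exists I, I \in S.
  by case: (S) sS ipos => [<-|I S'] // _ _; exists I; rewrite mem_head.
have IB : I.2 \notin B by rewrite eB in_setD inE map_f.
transitivity (NC_sum (covered S) B); last first.
  apply: eq_bigr => P _; rewrite /wt; congr (_ ^+ (_ + _)%N).
  by rewrite setIdE.
rewrite (NC_sum_moment IB) => [|a]; last first.
  rewrite inE antisingleton_inE => /hasP[J JS /andP[aJ neq]].
  apply/andP; split; rewrite inE; apply/hasP; exists J => //.
  exact: interval_step.
have -> : (#|covered S| - #|B| = i)%N by rewrite eA cB; lia.
have -> : (d - #|covered S| = j)%N by rewrite eA; lia.
by rewrite cB.
Qed.
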